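(* Let $n\ge 2$ and let $P_n$ be the path on $n$ vertices. If $i$ is a leaf of $P_n$, then $(P_n,i)$ allows the nullity pair $(k,\ell)$ if and only if $(k,\ell)\in\{(0,0),(1,0),(0,1)\}$. If $i\in V(P_n)$ is not a leaf, then the only nullity pair outside $\{(0,0),(1,0),(0,1)\}$ allowed by $(P_n,i)$ is $(1,2)$. Moreover, for any index $i$, a matrix $A\in\mathcal{S}(P_n)$ has the $i$-SNIP if and only if its $i$-nullity pair lies in $\{(0,0),(1,0),(0,1)\}$.
   Context: All matrices are real. For a simple graph $G$ on $[n]$, $\mathcal{S}(G)$ is the set of real symmetric $n\times n$ matrices whose off-diagonal $(j,k)$ entry is nonzero iff $\{j,k\}\in E(G)$ (diagonal free). $A(i)$ is $A$ with row and column $i$ deleted; the $i$-nullity pair of $A$ is $(\operatorname{null}(A),\operatorname{null}(A(i)))$. $(G,i)$ allows $(k,\ell)$ if some $A\in\mathcal{S}(G)$ has $i$-nullity pair $(k,\ell)$. $A$ has the $i$-SNIP if $X=O$ is the only real symmetric $X$ with $A\circ X=O$, $I\circ X=O$ and $(AX)(i,:]=O$ ($AX$ with row $i$ deleted). *)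

(* Defs.v *)
From mathcomp Require Import all_boot all_order all_algebra reals.

Set Implicit Arguments.
Unset Strict Implicit.
Unset Printing Implicit Defensive.

Import GRing.Theory.
Local Open Scope ring_scope.

Record sgraph (n : nat) := SGraph {
  edge :> rel 'I_n;
  edge_sym : symmetric edge;
  edge_irr : irreflexive edge
}.

Definition is_leaf (n : nat) (G : sgraph n) (i : 'I_n) : bool :=
  #|[set j | G i j]| == 1%N.

Definition path_rel (n : nat) : rel 'I_n :=
  fun j k => (j.+1 == k :> nat) || (k.+1 == j :> nat).

Lemma path_rel_sym n : symmetric (@path_rel n).
Proof. by move=> j k; rewrite /path_rel orbC. Qed.

Lemma path_rel_irr n : irreflexive (@path_rel n).
Proof. by move=> j; rewrite /path_rel orbb gtn_eqF. Qed.

Definition path_graph (n : nat) : sgraph n :=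
  SGraph (@path_rel_sym n) (@path_rel_irr n).

Section SymmetricMatrices.
Variable R : realType.

Definition in_S (n : nat) (G : sgraph n) (A : 'M[R]_n) : Prop :=
  A^T = A /\ forall j k : 'I_n, j != k -> (A j k != 0) = G j k.

(* The column space of [cokermx A] is the null space {v | A *m v = 0}. *)
Definition nullity (n : nat) (A : 'M[R]_n) : nat := \rank (cokermx A).

Definition del_rc (n : nat) (i : 'I_n) (A : 'M[R]_n) : 'M[R]_n.-1 :=
  row' i (col' i A).

Definition nullity_pair (n : nat) (i : 'I_n) (A : 'M[R]_n) : nat * nat :=
  (nullity A, nullity (del_rc i A)).

Definition allows (n : nat) (G : sgraph n) (i : 'I_n) (p : nat * nat) : Prop :=
  exists A : 'M[R]_n, in_S G A /\ nullity_pair i A = p.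

Definition hadamard (m n : nat) (A B : 'M[R]_(m, n)) : 'M[R]_(m, n) :=
  map2_mx *%R A B.

Definition SNIP (n : nat) (i : 'I_n) (A : 'M[R]_n) : Prop :=
  forall X : 'M[R]_n,
    X^T = X -> hadamard A X = 0 -> hadamard 1%:M X = 0 ->
    row' i (A *m X) = 0 -> X = 0.

End SymmetricMatrices.

Arguments allows R {n} G i p.

Definition basic_pairs : seq (nat * nat) := [:: (0, 0); (1, 0); (0, 1)]%N.

(* Main.v *)
(** If [A] or [A(i)] is nonsingular, then [A] with row [i] deleted has corank at
    most [1]; the matrices [X] in the definition of the SNIP then have rank at
    most [1], and a symmetric matrix of rank at most [1] with zero diagonal is
    zero.

    If both are singular, there is a nonzero [v] in the kernel of [A] with
    [v_i = 0]. The three-term recurrence along the path forces [v] to be nonzero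
    at both neighbours of [i], so [i] is not a leaf. The parts [w], [u] of [v] to
    the left and to the right of [i] are independent kernel vectors of [A(i)],
    hence the nullity pair is [(1, 2)], and [X = w u^T + u w^T] violates the
    SNIP. *)
Require Import Defs.
From mathcomp Require Import all_boot all_order all_algebra reals.
From mathcomp Require Import zify.

Set Implicit Arguments.
Unset Strict Implicit.
Unset Printing Implicit Defensive.

Import GRing.Theory Num.Theory.
Local Open Scope ring_scope.

(** * Rank: matrices of rank at most one, and deletion of a row or column *)

Section Rank.
Variable F : fieldType.

(** A rank factorization has inner dimension at most one, so every entry is a single product or
    zero. *)
Lemma rank_le1_minor m n (M : 'M[F]_(m, n)) a b c d :
  (\rank M <= 1)%N -> M a b * M c d = M a d * M c b.
Proof.
suff minor r (C : 'M[F]_(m, r)) (B : 'M_(r, n)) : (r <= 1)%N ->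
    (C *m B) a b * (C *m B) c d = (C *m B) a d * (C *m B) c b.
  by move/minor => /(_ (col_base M) (row_base M)); rewrite mulmx_base.
case: r C B => [|[|//]] C B _; rewrite !mxE ?big_ord0 ?big_ord1.
  by rewrite !mul0r.
by rewrite mulrACA [B 0 b * _]mulrC mulrACA.
Qed.

(** The principal minor on [j], [k] gives [X_jk^2 = X_jj X_kk = 0]. *)
Lemma sym_zero_diag_rank_le1 n (X : 'M[F]_n) :
  X^T = X -> (forall j, X j j = 0) -> (\rank X <= 1)%N -> X = 0.
Proof.
move=> symX diagX rkX; apply/matrixP => j k; rewrite mxE.
have := rank_le1_minor j k k j rkX.
rewrite !diagX mul0r -{2}symX mxE => /eqP.
by rewrite mulf_eq0 orbb => /eqP.
Qed.

Lemma rank_row'_le m n (i : 'I_m) (M : 'M[F]_(m, n)) :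
  (\rank (row' i M) <= \rank M)%N.
Proof. by rewrite row'Esub rowsubE mxrankM_maxr. Qed.

Lemma rank_le_row' m n (i : 'I_m) (M : 'M[F]_(m, n)) :
  (\rank M <= (\rank (row' i M)).+1)%N.
Proof.
have sub : (M <= row' i M + row i M)%MS.
  apply/row_subP => j; case: (unliftP i j) => [k ->|->].
    apply: submx_trans (addsmxSl _ _).
    by apply: (eq_row_sub k); apply/rowP => l; rewrite !mxE.
  exact: addsmxSr.
apply: leq_trans (mxrankS sub) _.
apply: leq_trans (mxrank_adds_leqif _ _) _.
by have := rank_leq_row (row i M); lia.
Qed.

Lemma tr_row'_col' n (i : 'I_n) (M : 'M[F]_n) :
  (row' i (col' i M))^T = col' i (row' i M^T).
Proof. by apply/matrixP => j k; rewrite !mxE. Qed.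

Lemma row'_col'C n (i : 'I_n) (M : 'M[F]_n) :
  row' i (col' i M) = col' i (row' i M).
Proof. by apply/matrixP => j k; rewrite !mxE. Qed.

Lemma rank_row'_bounds n (i : 'I_n) (M : 'M[F]_n) :
  [/\ (\rank (row' i (col' i M)) <= \rank (row' i M))%N,
      (\rank (row' i M) <= (\rank (row' i (col' i M))).+1)%N,
      (\rank (row' i M) <= \rank M)%N
    & (\rank M <= (\rank (row' i M)).+1)%N].
Proof.
rewrite row'_col'C -(mxrank_tr (col' i _)) -(mxrank_tr (row' i M)) tr_col'.
by rewrite rank_row'_le rank_le_row' mxrank_tr rank_row'_le rank_le_row'.
Qed.

End Rank.

(** * Nullities of [A] and [A(i)], and a sufficient condition for the SNIP *)

Section PathNullity.
Variable R : realType.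

Lemma nullity_gt0P n (A : 'M[R]_n) :
  reflect (exists2 v : 'rV_n, v != 0 & v *m A = 0) (0 < nullity A)%N.
Proof.
rewrite /nullity mxrank_coker -mxrank_ker lt0n mxrank_eq0.
apply: (iffP rowV0Pn) => -[v].
  by move=> /sub_kermxP vA vn0; exists v.
by move=> vn0 /sub_kermxP vA; exists v.
Qed.

(** Both [A] and [A(i)] are one row or column away from [row' i A], so its corank [d] exceeds either
    nullity by at most one. *)
Lemma corank_row'_bounds n (i : 'I_n) (A : 'M[R]_n) :
  let d := (n - \rank (row' i A))%N in
  (nullity A <= d <= (nullity A).+1)%N /\
  (nullity (del_rc i A) <= d <= (nullity (del_rc i A)).+1)%N.
Proof.
rewrite /nullity !mxrank_coker /del_rc.
have [] := rank_row'_bounds i A; have := rank_leq_row A.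
have := rank_leq_row (row' i (col' i A)); have := ltn_ord i.
move: (\rank A) (\rank (row' i A)) (\rank (row' i (col' i A))) => a b c.
by lia.
Qed.

Lemma nullity_pair_bounds n (i : 'I_n) (A : 'M[R]_n) :
  (nullity A <= (nullity (del_rc i A)).+1)%N /\
  (nullity (del_rc i A) <= (nullity A).+1)%N.
Proof. by have := corank_row'_bounds i A; lia. Qed.

Lemma SNIP_of_nonsingular n (i : 'I_n) (A : 'M[R]_n) :
  nullity A = 0%N \/ nullity (del_rc i A) = 0%N -> SNIP i A.
Proof.
move=> null0 X symX _ diagX AX0.
apply: sym_zero_diag_rank_le1 => //.
  by move=> j; move/matrixP/(_ j j): diagX; rewrite !mxE eqxx mul1r.
(* The columns of [X] lie in the null space of [row' i A], so [X] has rank at most [d <= 1]. *)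
have : (\rank (row' i A) + \rank X <= n)%N.
  by apply: mulmx0_rank_max; rewrite row'Esub mul_rowsub_mx -row'Esub.
by have := corank_row'_bounds i A; lia.
Qed.

(** * Kernel vectors of matrices of the path *)

Section Path.
Variables (n : nat) (A : 'M[R]_n).
Hypothesis SA : in_S (path_graph n) A.

Lemma in_S_path_sym j k : A j k = A k j.
Proof. by case: SA => symA _; rewrite -{1}symA mxE. Qed.

Lemma in_S_path_neq0 j k : j != k -> (A j k != 0) = path_rel j k.
Proof. by case: SA => _; apply. Qed.

(** Zero forcing: in equation [j] of [v A = 0] only the term of [k] can survive, and its coefficient
    is nonzero. *)
Lemma kernel_forcing (v : 'rV[R]_n) (j k : 'I_n) :
  v *m A = 0 -> path_rel j k -> v 0 j = 0 ->
  (forall l, path_rel j l -> l != k -> v 0 l = 0) -> v 0 k = 0.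
Proof.
move=> /rowP/(_ j) vA jk vj vl; move: vA; rewrite !mxE (bigD1 k) //= big1.
  move/eqP; rewrite addr0 mulf_eq0 in_S_path_sym => /orP[/eqP//|/eqP A0].
  have : A j k != 0.
    rewrite in_S_path_neq0 //; apply: contraTneq jk => ->.
    by rewrite path_rel_irr.
  by rewrite A0 eqxx.
move=> l lk; have [->|jl] := eqVneq l j; first by rewrite vj mul0r.
have [A0|] := eqVneq (A l j) 0; first by rewrite A0 mulr0.
by rewrite in_S_path_neq0 // path_rel_sym => /vl ->; rewrite ?mul0r.
Qed.

(* The shift by one makes the condition vacuous at [k = 0] and [k > n], so that
   both ends of the path obey the same three-term recurrence. *)
Let vanishes (v : 'rV[R]_n) (k : nat) :=
  forall j : 'I_n, j.+1 = k -> v 0 j = 0.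

Let vanishesS (v : 'rV[R]_n) k : v *m A = 0 ->
  vanishes v k -> vanishes v k.+1 -> vanishes v k.+2.
Proof.
move=> vA v0 v1 j jk.
have kn : (k < n)%N by have := ltn_ord j; lia.
apply: (@kernel_forcing v (Ordinal kn)) => //.
- by rewrite /path_rel /=; lia.
- exact: v1.
- by move=> l; rewrite /path_rel -val_eqE /= => kl lj; apply: v0; lia.
Qed.

Let vanishesP (v : 'rV[R]_n) k : v *m A = 0 -> (k < n)%N ->
  vanishes v k.+1 -> vanishes v k.+2 -> vanishes v k.
Proof.
move=> vA kn v1 v2 j jk.
apply: (@kernel_forcing v (Ordinal kn)) => //.
- by rewrite /path_rel /=; lia.
- exact: v1.
- by move=> l; rewrite /path_rel -val_eqE /= => kl lj; apply: v2; lia.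
Qed.

(** Two consecutive zeros are carried down to positions 0 and 1, then up along the whole path. *)
Let vanishes_all (v : 'rV[R]_n) k : v *m A = 0 -> (k <= n)%N ->
  vanishes v k -> vanishes v k.+1 -> v = 0.
Proof.
move=> vA; elim: k => [_|k IH kn] v0 v1; last first.
  by apply: IH => //; [exact: ltnW | exact: vanishesP].
have {v0 v1}v01 m : vanishes v m /\ vanishes v m.+1.
  by elim: m => // m [vm vm1]; split=> //; exact: vanishesS.
by apply/rowP => j; rewrite mxE; apply: (v01 j).2.
Qed.

(** Vertex [i] has shifted position [i.+1]. If a neighbour were missing or carried a zero, two
    consecutive positions would vanish, forcing [v = 0]. *)
Lemma kernel_neighbors (v : 'rV[R]_n) (i : 'I_n) :
  v *m A = 0 -> v != 0 -> v 0 i = 0 ->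
  exists j k : 'I_n, [/\ j.+1 = i, k = i.+1 :> nat, v 0 j != 0 & v 0 k != 0].
Proof.
move=> vA /eqP vn0 vi; have v1 : vanishes v i.+1.
  by move=> j [] /val_inj ->.
have [/existsP[j /andP[/eqP ji vj]]|no] :=
    boolP [exists j : 'I_n, (j.+1 == i) && (v 0 j != 0)]; last first.
  case: vn0; apply: (vanishes_all vA (ltnW (ltn_ord i))) => // j ji.
  by move/existsPn/(_ j): no; rewrite ji eqxx /= negbK => /eqP.
have [/existsP[k /andP[/eqP ki vk]]|no] :=
    boolP [exists k : 'I_n, (k == i.+1 :> nat) && (v 0 k != 0)]; last first.
  case: vn0; apply: (vanishes_all vA (ltn_ord i)) => // k [ki].
  by move/existsPn/(_ k): no; rewrite ki eqxx /= negbK => /eqP.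
by exists j, k.
Qed.

Lemma kernel_first_eq0 (v : 'rV[R]_n) (i : 'I_n) :
  v *m A = 0 -> i = 0%N :> nat -> v 0 i = 0 -> v = 0.
Proof.
move=> vA i0 vi; apply/eqP; apply: contraT => vn0.
by have [j [k [ji _ _ _]]] := kernel_neighbors vA vn0 vi; rewrite i0 in ji.
Qed.

(** Evaluation at the first vertex is injective on the kernel. *)
Lemma path_nullity_le1 : (nullity A <= 1)%N.
Proof.
have [n0|n_gt0] := posnP n.
  by rewrite /nullity mxrank_coker; lia.
pose i := Ordinal n_gt0; pose e : 'cV[R]_n := delta_mx i 0.
have /mxrank_injP eK : (kermx A :&: kermx e)%MS == 0.
  apply/rowV0P => v; rewrite sub_capmx => /andP[/sub_kermxP vA /sub_kermxP ve].
  apply: (kernel_first_eq0 (i := i)) => //.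
  by move/rowP/(_ 0): ve; rewrite -colE !mxE.
rewrite /nullity mxrank_coker -mxrank_ker -eK.
exact: rank_leq_col.
Qed.

(* A kernel vector of [A(i)] extended by [0] is mapped by [A] to a multiple of
   [e_i]: if the multiple is zero, this is the desired vector, otherwise
   pairing with any kernel vector of [A] shows that the latter vanishes at [i]. *)
Lemma kernel_vector_at (i : 'I_n) :
  (0 < nullity A)%N -> (0 < nullity (del_rc i A))%N ->
  exists v : 'rV[R]_n, [/\ v *m A = 0, v != 0 & v 0 i = 0].
Proof.
move=> /nullity_gt0P[v vn0 vA] /nullity_gt0P[z zn0 zA].
pose w : 'rV[R]_n := z *m row' i 1%:M.
have wA j : j != i -> (w *m A) 0 j = 0.
  case: (unliftP i j) => [k -> _|->]; last by rewrite eqxx.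
  move/rowP/(_ k): zA; rewrite /w -mulmxA row'Esub mul_rowsub_mx mul1mx.
  by rewrite !mxE => zA; rewrite -[RHS]zA; apply: eq_bigr => l _; rewrite !mxE.
have wlift k : w 0 (lift i k) = z 0 k.
  rewrite mxE (bigD1 k) //= !mxE eqxx mulr1 big1 ?addr0 // => l lk.
  by rewrite !mxE (inj_eq lift_inj) (negPf lk) mulr0.
have wi : w 0 i = 0.
  by rewrite mxE big1 // => l _; rewrite !mxE eq_sym (negPf (neq_lift _ _)) mulr0.
have [wAi|wAi] := eqVneq ((w *m A) 0 i) 0.
  exists w; split=> //.
    by apply/rowP => j; rewrite [RHS]mxE; have [->|/wA] := eqVneq j i.
  by apply: contraNneq zn0 => w0; apply/eqP/rowP => k; rewrite -wlift w0 !mxE.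
exists v; split=> //.
have : w *m A *m v^T = 0.
  have Av : A *m v^T = 0 by rewrite -(proj1 SA) -trmx_mul vA trmx0.
  by rewrite -mulmxA Av mulmx0.
move/rowP/(_ 0); rewrite !mxE (bigD1 i) //= big1 => [|j ji].
  move/eqP; rewrite addr0 mulf_eq0 (negPf wAi) /= mxE.
  by move/eqP.
by rewrite wA // mul0r.
Qed.

(** When [v] is a row, this is [w^T u + u^T w] for its parts [w], [u] on the two sides of [i]. *)
Definition cross_mx (i : 'I_n) (v : 'rV[R]_n) : 'M[R]_n :=
  \matrix_(j, k) if (j < i < k)%N || (k < i < j)%N then v 0 j * v 0 k else 0.

Lemma cross_mx_sym i v : (cross_mx i v)^T = cross_mx i v.
Proof. by apply/matrixP => j k; rewrite !mxE orbC mulrC. Qed.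

Lemma cross_mx_diag i v j : cross_mx i v j j = 0.
Proof. by rewrite mxE; case: ifP => //; lia. Qed.

Lemma cross_mx_row i v k : cross_mx i v i k = 0.
Proof. by rewrite mxE; case: ifP => //; lia. Qed.

(** Since [i] separates the path, row [j] of [A] meets only indices on the side of [j], and possibly
    [i], where [v] and the cross matrix vanish. The factor [c] from the other side thus comes out of
    the sum, leaving [c (v A)_j = 0]. *)
Lemma mulmx_cross (i : 'I_n) (v : 'rV[R]_n) :
  v *m A = 0 -> v 0 i = 0 -> row' i (A *m cross_mx i v) = 0.
Proof.
move=> vA vi; apply/matrixP => j' k; rewrite !mxE.
have /negbTE ij := neq_lift i j'; set j := lift i j' in ij *.
pose c := if (j < i < k)%N || (k < i < j)%N then v 0 k else 0.
transitivity (c * (v *m A) 0 j); last by rewrite vA mxE mulr0.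
rewrite mxE mulr_sumr; apply: eq_bigr => l _; rewrite (in_S_path_sym l j).
have [->|li] := eqVneq l i; first by rewrite cross_mx_row vi mul0r !mulr0.
have [->|A0] := eqVneq (A j l) 0; first by rewrite mul0r !mulr0.
have side : (l < i)%N = (j < i)%N /\ (i < l)%N = (i < j)%N.
  move: ij li A0; have [->//|jl] := eqVneq j l.
  by rewrite in_S_path_neq0 // /path_rel -!val_eqE /=; lia.
rewrite mxE /c side.1 side.2; case: ifP => _; last by rewrite mulr0 mul0r.
by rewrite mulrC mulrAC [LHS]mulrC mulrA.
Qed.

(** Indices strictly on opposite sides of [i] are distinct and not adjacent. *)
Lemma hadamard_cross i v : hadamard A (cross_mx i v) = 0.
Proof.
apply/matrixP => j k; rewrite !mxE; case: ifP => [jk|_]; last by rewrite mulr0.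
have jk' : j != k by rewrite -val_eqE /=; lia.
have [->|] := eqVneq (A j k) 0; first by rewrite mul0r.
by rewrite in_S_path_neq0 // /path_rel; lia.
Qed.

Lemma both_singular (i : 'I_n) :
  (0 < nullity A)%N -> (0 < nullity (del_rc i A))%N ->
  [/\ nullity_pair i A = (1%N, 2%N), ~ SNIP i A
    & exists j k : 'I_n, j.+1 = i /\ k = i.+1 :> nat].
Proof.
move=> nA nAi; have [v [vA vn0 vi]] := kernel_vector_at nA nAi.
have [j [k [ji ki vj vk]]] := kernel_neighbors vA vn0 vi.
have Xn0 : cross_mx i v j k != 0.
  by rewrite mxE ifT ?mulf_neq0 //; lia.
split; last by exists j, k.
- have [_ le2] := nullity_pair_bounds i A; have le1 := path_nullity_le1.
  (* If [A(i)] had nullity at most one, the cross matrix without row and column [i] would have rank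
     at most one, as [A(i)] annihilates it. It would then be zero, contradicting its entry at the
     two neighbours of [i]. *)
  suff ge2 : (1 < nullity (del_rc i A))%N.
    by rewrite /nullity_pair; congr (_, _); lia.
  rewrite ltnNge; apply: contra_neqN Xn0 => rk1.
  have X0 : del_rc i (cross_mx i v) = 0.
    apply: sym_zero_diag_rank_le1.
    + by rewrite tr_row'_col' cross_mx_sym -row'_col'C.
    + by move=> l; rewrite !mxE; case: ifP => //; lia.
    + have : del_rc i A *m del_rc i (cross_mx i v) = 0.
        apply/matrixP => p q; rewrite !mxE.
        have /matrixP/(_ p (lift i q)) := mulmx_cross vA vi; rewrite !mxE.
        move=> E; rewrite -[RHS]E (bigD1_ord i) //= cross_mx_row mulr0 add0r.
        by apply: eq_bigr => l _; rewrite !mxE.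
      move/mulmx0_rank_max; move: rk1; rewrite /nullity mxrank_coker.
      by have := rank_leq_row (del_rc i A); lia.
  have ij : i != j by rewrite -val_eqE /=; lia.
  have ik : i != k by rewrite -val_eqE /=; lia.
  have [j' Ej _] := unlift_some ij; have [k' Ek _] := unlift_some ik.
  by move/matrixP/(_ j' k'): X0; rewrite !mxE -Ej -Ek.
- move=> snip; have X0 : cross_mx i v = 0.
    apply: snip (cross_mx_sym i v) (hadamard_cross i v) _ (mulmx_cross vA vi).
    apply/matrixP => p q; rewrite [LHS]mxE [1%:M _ _]mxE [RHS]mxE.
    by case: eqP => [->|_]; rewrite ?cross_mx_diag ?mulr0 // mul0r.
  by rewrite X0 mxE eqxx in Xn0.
Qed.

(** The two nullities differ by at most one, so a pair with a zero component is basic; otherwise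
    both matrices are singular. *)
Lemma path_nullity_pair (i : 'I_n) :
  (nullity_pair i A \in basic_pairs /\ SNIP i A) \/
  [/\ nullity_pair i A = (1%N, 2%N), ~ SNIP i A
    & exists j k : 'I_n, j.+1 = i /\ k = i.+1 :> nat].
Proof.
have [le1 le2] := nullity_pair_bounds i A.
have [n0|nA] := posnP (nullity A).
  left; split; last by apply: SNIP_of_nonsingular; left.
  rewrite /nullity_pair n0 in le2 *.
  by case: (nullity (del_rc i A)) le2 => [|[|//]].
have [n0|nAi] := posnP (nullity (del_rc i A)).
  left; split; last by apply: SNIP_of_nonsingular; right.
  rewrite /nullity_pair n0 in le1 *.
  by case: (nullity A) le1 => [|[|//]].
by right; apply: both_singular.
Qed.

End Path.

(** * Matrices of the path with a prescribed kernel vector *)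

Section Examples.
Variable n : nat.

(* The diagonal is chosen so that [v *m path_mx v] vanishes at every index where
   [v] does not. *)
Definition path_mx (v : 'rV[R]_n) : 'M[R]_n := \matrix_(j, k)
  if j == k then - (\sum_l v 0 l * (path_rel l j)%:R) / v 0 j
  else (path_rel j k)%:R.

Lemma path_mx_in_S v : in_S (path_graph n) (path_mx v).
Proof.
split; first apply/matrixP => j k; rewrite ?mxE.
  by rewrite eq_sym path_rel_sym; case: eqP => // ->.
by move=> j k jk; rewrite mxE (negPf jk) pnatr_eq0 eqb0 negbK.
Qed.

Lemma mul_path_mxE (v : 'rV[R]_n) j : (v *m path_mx v) 0 j =
  if v 0 j == 0 then \sum_l v 0 l * (path_rel l j)%:R else 0.
Proof.
rewrite !mxE (bigD1 j) //= mxE eqxx.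
have -> : \sum_(l < n | l != j) v 0 l * path_mx v l j =
          \sum_l v 0 l * (path_rel l j)%:R.
  rewrite [RHS](bigD1 j) //= path_rel_irr mulr0 add0r.
  by apply: eq_bigr => l lj; rewrite mxE (negPf lj).
case: eqP => [->|/eqP vj]; first by rewrite mul0r add0r.
by rewrite mulrCA divff // mulr1 addNr.
Qed.

(** Removing the zero entry [v_i] leaves a kernel vector of [A(i)], nonzero because an index other
    than [i] exists. *)
Lemma del_rc_path_mx_singular (v : 'rV[R]_n) (i : 'I_n) : (1 < n)%N ->
  (forall j, (v 0 j == 0) = (j == i)) -> (0 < nullity (del_rc i (path_mx v)))%N.
Proof.
move=> n_gt1 v0; apply/nullity_gt0P; exists (col' i v).
  have n'_gt0 : (0 < n.-1)%N by lia.
  apply/eqP => /rowP/(_ (Ordinal n'_gt0)); rewrite !mxE => /eqP.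
  by rewrite v0 eq_sym (negPf (neq_lift _ _)).
apply/rowP => j; have := mul_path_mxE v (lift i j).
rewrite v0 eq_sym (negPf (neq_lift _ _)) !mxE => E; rewrite -[RHS]E.
rewrite [RHS](bigD1_ord i) //=.
have /eqP -> : v 0 i == 0 by rewrite v0.
by rewrite mul0r add0r; apply: eq_bigr => l _; rewrite !mxE.
Qed.

(** For the all-ones vector, [path_mx] is the negative of the graph Laplacian. *)
Lemma path_laplacian_mul1 : (const_mx 1 : 'rV[R]_n) *m path_mx (const_mx 1) = 0.
Proof. by apply/rowP => j; rewrite mul_path_mxE !mxE oner_eq0. Qed.

Lemma path_laplacian_singular : (0 < n)%N ->
  (0 < nullity (path_mx (const_mx 1%R)))%N.
Proof.
move=> n_gt0; apply/nullity_gt0P; exists (const_mx 1); last first.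
  exact: path_laplacian_mul1.
by apply/eqP => /rowP/(_ (Ordinal n_gt0)); rewrite !mxE; apply/eqP/oner_neq0.
Qed.

End Examples.

(** * Leaves of the path, and realization of the pairs *)

Lemma path_leafPn n (i : 'I_n) : (1 < n)%N ->
  reflect (exists j k : 'I_n, j.+1 = i /\ k = i.+1 :> nat)
          (~~ is_leaf (path_graph n) i).
Proof.
move=> n_gt1; apply: (iffP idP) => [|[j [k [ji ki]]]]; last first.
  apply/cards1P => -[x /setP E]; move: (E j) (E k).
  by rewrite !inE /= /path_rel -!val_eqE /=; lia.
have [i_gt0|i0] := boolP (0 < i)%N; last first.
  case/cards1P; exists (Ordinal n_gt1); apply/setP => l.
  by rewrite !inE /= /path_rel -!val_eqE /=; lia.
have jn : (i.-1 < n)%N by have := ltn_ord i; lia.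
have [kn|nk] := boolP (i.+1 < n)%N.
  by exists (Ordinal jn), (Ordinal kn); split=> //=; lia.
case/cards1P; exists (Ordinal jn); apply/setP => l.
by rewrite !inE /= /path_rel -!val_eqE /=; have := ltn_ord l; lia.
Qed.

(** At a leaf every pair is basic, so making [A] or [A(i)] singular already determines the pair.
    This settles [(1, 0)] and [(0, 1)]. *)
Lemma leaf_allows n (i : 'I_n) k l : (1 < n)%N -> is_leaf (path_graph n) i ->
  allows R (path_graph n) i (k, l) <-> (k, l) \in basic_pairs.
Proof.
move=> n_gt1 leaf_i.
have leaf_pair (A : 'M[R]_n) : in_S (path_graph n) A ->
    nullity_pair i A \in basic_pairs.
  move=> SA; case: (path_nullity_pair SA i) => [[]//|[_ _ nleaf]].
  by move/(path_leafPn _ n_gt1): nleaf; rewrite leaf_i.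
split=> [[A [SA <-]]|]; first exact: leaf_pair.
have n_gt0 : (0 < n)%N by lia.
have LS := path_mx_in_S (const_mx 1 : 'rV[R]_n).
have L10 : nullity_pair i (path_mx (const_mx 1 : 'rV[R]_n)) = (1%N, 0%N).
  have := leaf_pair _ LS; have := path_laplacian_singular n_gt0.
  by rewrite /nullity_pair !inE !xpair_eqE => ? ?; congr (_, _); lia.
rewrite !inE => /or3P[] /eqP ->; last first.
- pose v : 'rV[R]_n := \row_j (j != i)%:R.
  have SA := path_mx_in_S v; exists (path_mx v); split=> //.
  have v0 j : (v 0 j == 0) = (j == i) by rewrite mxE pnatr_eq0 eqb0 negbK.
  have := leaf_pair _ SA; have := del_rc_path_mx_singular n_gt1 v0.
  by rewrite /nullity_pair !inE !xpair_eqE => ? ?; congr (_, _); lia.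
- by exists (path_mx (const_mx 1)).
(* For [(0, 0)], changing the entry of [L] at [(i, i)] keeps [L(i)], which is nonsingular, and
   destroys the kernel of [L]. *)
pose L := path_mx (const_mx 1 : 'rV[R]_n).
have SA : in_S (path_graph n) (L + delta_mx i i).
  case: LS => symL supL; split; first by rewrite linearD /= symL trmx_delta.
  move=> p q pq; rewrite [_ p q]mxE [delta_mx _ _ _ _]mxE.
  suff -> : (p == i) && (q == i) = false by rewrite addr0 supL.
  by apply: contraNF pq => /andP[/eqP-> /eqP->].
exists (L + delta_mx i i); split=> //.
have L0 : nullity (del_rc i (L + delta_mx i i)) = 0%N.
  have -> : del_rc i (L + delta_mx i i) = del_rc i L.
    apply/matrixP => p q; rewrite !mxE.
    by rewrite [lift i p == i]eq_sym (negPf (neq_lift _ _)) addr0.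
  by case: L10.
rewrite /nullity_pair L0; congr (_, _); apply/eqP; rewrite -leqn0 leqNgt.
apply/negP => /nullity_gt0P[v vn0]; rewrite mulmxDr => /eqP vLi.
have symL : L^T = L by case: LS.
(* Pairing [v (L + delta_mx i i) = 0] with the all-ones kernel vector of [L] leaves [v_i = 0]. Then
   [v] is in the kernel of [L] and vanishes at a leaf, which is impossible. *)
have vi : v 0 i = 0.
  have L1 : L *m (const_mx 1 : 'cV[R]_n) = 0.
    by rewrite -symL -trmx_const -trmx_mul path_laplacian_mul1 trmx0.
  move/eqP/(congr1 (mulmx^~ (const_mx 1 : 'cV_n))): vLi.
  rewrite mulmxDl -mulmxA L1 mulmx0 add0r mul0mx => /rowP/(_ 0).
  rewrite -mulmxA -(mul_delta_mx (0 : 'I_1)) -mulmxA mulmxA -colE.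
  by rewrite -rowE !mxE big_ord1 !mxE mulr1.
have vL : v *m L = 0.
  move/eqP: vLi => /rowP vLi; apply/rowP => j; rewrite -[RHS]vLi [RHS]mxE.
  rewrite [X in _ + X](_ : _ = 0) ?addr0 // mxE big1 // => m _.
  by rewrite mxE; case: eqP => [->|_]; rewrite ?vi ?mul0r ?mulr0.
have [p [q [pi qi _ _]]] := kernel_neighbors LS vL vn0 vi.
have /(path_leafPn _ n_gt1) : exists p q : 'I_n, p.+1 = i /\ q = i.+1 :> nat.
  by exists p, q.
by rewrite leaf_i.
Qed.

Lemma nonleaf_allows12 n (i : 'I_n) : (1 < n)%N ->
  ~~ is_leaf (path_graph n) i -> allows R (path_graph n) i (1%N, 2%N).
Proof.
move=> n_gt1 /(path_leafPn _ n_gt1)[j [k [ji ki]]].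
(* The diagonal of [path_mx] settles every equation except the one at [i]; there the opposite signs
   of the two neighbours cancel. *)
pose v : 'rV[R]_n := \row_l (if l == i then 0 else if (l < i)%N then 1 else -1).
have v0 l : (v 0 l == 0) = (l == i).
  rewrite mxE; have [_|_] := eqVneq l i; first by rewrite eqxx.
  by case: ifP => _; rewrite ?oppr_eq0 oner_eq0.
have SA := path_mx_in_S v; exists (path_mx v); split=> //.
have nAi := del_rc_path_mx_singular n_gt1 v0.
suff nA : (0 < nullity (path_mx v))%N by case: (both_singular SA nA nAi).
have ij : j != i by rewrite -val_eqE /=; lia.
have ik : k != i by rewrite -val_eqE /=; lia.
apply/nullity_gt0P; exists v.
  by apply/eqP => /rowP/(_ j) /eqP; rewrite [X in _ == X]mxE v0 (negPf ij).
apply/rowP => l; rewrite mul_path_mxE v0 [RHS]mxE.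
case: eqP => // {l}->; rewrite (bigD1 j) //= (bigD1 k) /=; last first.
  by rewrite -val_eqE /=; lia.
rewrite big1 => [|l]; last first.
  rewrite -!val_eqE /= => lj; rewrite (_ : path_rel l i = false) ?mulr0 //.
  by rewrite /path_rel; lia.
have -> : path_rel j i by rewrite /path_rel; lia.
have -> : path_rel k i by rewrite /path_rel; lia.
rewrite !mxE (negPf ij) (negPf ik) !mulr1 addr0.
have -> : (j < i)%N by lia.
have -> : (k < i)%N = false by lia.
exact: subrr.
Qed.

End PathNullity.

Theorem proposition4p5 (R : realType) (n : nat) (hn : (2 <= n)%N) (i : 'I_n) :
  (is_leaf (path_graph n) i ->
     forall k l : nat,
       allows R (path_graph n) i (k, l) <-> (k, l) \in basic_pairs) /\
  (~~ is_leaf (path_graph n) i ->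
     forall k l : nat, (k, l) \notin basic_pairs ->
       (allows R (path_graph n) i (k, l) <-> (k, l) = (1%N, 2%N))) /\
  (forall A : 'M[R]_n, in_S (path_graph n) A ->
     (SNIP i A <-> nullity_pair i A \in basic_pairs)).
Proof.
split; [|split] => [leaf k l|nleaf k l nbasic|A SA].
- exact: leaf_allows.
- split=> [[A [SA Akl]]|->]; last exact: nonleaf_allows12.
  by move: nbasic; rewrite -Akl; case: (path_nullity_pair SA i) => [[->]|[->]].
- by case: (path_nullity_pair SA i) => [[->]|[-> ? _]].
Qed.
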